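(* Let $G$ and $H$ be finite simple connected graphs with disjoint vertex sets, and let $+(G,H)$ be their join. Then $$M^{ev}(+(G,H)) = M^{ev}(G) + M^{ev}(H) + 2n(H)M_1(G) + 2n(G)M_1(H) - 6n(H)\eta(G) - 6n(G)\eta(H) + n(H)^2m(G) + n(G)^2m(H) + \bigl(n(G)+n(H)\bigr)^2 n(G)n(H).$$
   Context: For a finite simple graph $K$: $V(K)$ and $E(K)$ are its vertex and edge sets, $n(K)=|V(K)|$, $m(K)=|E(K)|$, $d_K(x)$ is the degree of the vertex $x$, $N[x]$ is the closed neighbourhood of $x$, and $\eta(K)$ is the total number of triangles in $K$. For an edge $e=xy$ of $K$, the edge-vertex degree is $deg^{ev}_K(e)=|N[x]\cup N[y]|$; equivalently $deg^{ev}_K(e)=d_K(x)+d_K(y)-\eta_K(e)$, where $\eta_K(e)$ is the number of triangles of $K$ containing $e$. The $ev$-degree Zagreb index is $M^{ev}(K)=\sum_{e\in E(K)} deg^{ev}_K(e)^2$. The first Zagreb index is $M_1(K)=\sum_{x\in V(K)} d_K(x)^2$. The join $+(G,H)$ has vertex set $V(G)\cup V(H)$ and edge set consisting of $E(G)\cup E(H)$ together with all edges joining a vertex of $G$ to a vertex of $H$. *)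

(* Defs.v *)
From HB Require Import structures.
From mathcomp Require Import all_boot all_order all_algebra.

Set Implicit Arguments.
Unset Strict Implicit.
Unset Printing Implicit Defensive.

(* Finite simple graphs: a symmetric irreflexive relation on a finType. *)
Record sgraph := SGraph {
  vertex :> finType;
  adj : rel vertex;
  adj_sym : symmetric adj;
  adj_irrefl : irreflexive adj
}.

Definition connected_graph (K : sgraph) : Prop :=
  forall x y : K, connect (@adj K) x y.

Definition edges (K : sgraph) : {set {set K}} :=
  [set e : {set K} | [exists x : K, exists y : K, adj x y && (e == [set x; y])]].

Definition order_graph (K : sgraph) : nat := #|K|.

Definition size_graph (K : sgraph) : nat := #|edges K|.

Definition degree (K : sgraph) (x : K) : nat := #|[set y : K | adj x y]|.

Definition closed_nbhd (K : sgraph) (x : K) : {set K} :=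
  x |: [set y : K | adj x y].

Definition triangles (K : sgraph) : {set {set K}} :=
  [set t : {set K} | (#|t| == 3) &&
     [forall x in t, forall y in t, (x != y) ==> adj x y]].

Definition num_triangles (K : sgraph) : nat := #|triangles K|.

(* Edges are unordered pairs, so |N[x] U N[y]| for e = xy is written as a
   union over the endpoints of e; see ev_degreeE. *)
Definition ev_degree (K : sgraph) (e : {set K}) : nat :=
  #|\bigcup_(x in e) closed_nbhd x|.

Lemma ev_degreeE (K : sgraph) (x y : K) :
  ev_degree [set x; y] = #|closed_nbhd x :|: closed_nbhd y|.
Proof. by rewrite /ev_degree bigcup_setU !big_set1. Qed.

Definition ev_zagreb (K : sgraph) : nat :=
  \sum_(e in edges K) ev_degree e ^ 2.

Definition first_zagreb (K : sgraph) : nat :=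
  \sum_(x : K) degree x ^ 2.

(* The disjointness of the two vertex sets is built in through the sum type. *)
Definition join_adj (G H : sgraph) (u v : G + H) : bool :=
  match u, v with
  | inl x, inl y => adj x y
  | inr x, inr y => adj x y
  | _, _ => true
  end.

Lemma join_adj_sym (G H : sgraph) : symmetric (@join_adj G H).
Proof. by move=> [x|x] [y|y] //=; rewrite adj_sym. Qed.

Lemma join_adj_irrefl (G H : sgraph) : irreflexive (@join_adj G H).
Proof. by move=> [x|x] /=; rewrite adj_irrefl. Qed.

Definition join_graph (G H : sgraph) : sgraph :=
  SGraph (@join_adj_sym G H) (@join_adj_irrefl G H).

(* Main.v *)
Require Import Defs.
From mathcomp Require Import all_boot all_order all_algebra.
From mathcomp Require Import ring.

(** The edges of the join are those of [G], those of [H], and the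
    [n(G) * n(H)] cross edges.  Every vertex of the other side lies in the
    neighbourhood of an end of an edge [e] of [G], so passing to the join raises
    the ev-degree of [e] by exactly [n(H)]; a cross edge dominates everything and
    has ev-degree [n(G) + n(H)].  Hence ([ev_zagreb_join])
      [M^ev(+(G,H)) = \sum_(e in E(G)) (deg^ev e + n(H))^2
         + \sum_(e in E(H)) (deg^ev e + n(G))^2 + n(G) n(H) (n(G) + n(H))^2].
    Expanding the squares leaves one unknown per graph, the sum of the
    ev-degrees, and this is [M_1 - 3 eta] ([sum_ev_degree]): inclusion-exclusion
    on an edge [xy] gives [deg^ev(xy) = d(x) + d(y) - eta(xy)]; summed over the
    edges, the degrees give [M_1], each vertex [x] contributing [d(x)] once for
    each of its [d(x)] edges, and each triangle is counted by its three edges.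

    Edges are two-element sets, which are awkward to split along the two sides of
    the join, so sums over edges are computed as halves of sums over ordered pairs
    of adjacent vertices ([sum_darts]). *)

Lemma edgesP (K : sgraph) (e : {set K}) :
  reflect (exists x y : K, adj x y /\ e = [set x; y]) (e \in edges K).
Proof.
rewrite inE; apply: (iffP existsP) => [[x /existsP[y /andP[xy /eqP->]]]|].
  by exists x, y.
by move=> [x [y [xy ->]]]; exists x; apply/existsP; exists y; rewrite xy eqxx.
Qed.

Lemma adj_neq (K : sgraph) (x y : K) : adj x y -> x != y.
Proof. by apply: contraTneq => ->; rewrite adj_irrefl. Qed.

Lemma eq_set2 (T : finType) (x y a b : T) : x != y ->
  ([set a; b] == [set x; y]) =
    ((a, b) == (x, y)) || ((a, b) == (y, x)).
Proof.
move=> neq_xy; apply/eqP/orP => [eq_ab|[] /eqP[-> ->] //]; last exact: setUC.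
have : a \in [set x; y] by rewrite -eq_ab set21.
have : b \in [set x; y] by rewrite -eq_ab set22.
have : x \in [set a; b] by rewrite eq_ab set21.
have : y \in [set a; b] by rewrite eq_ab set22.
rewrite !inE !xpair_eqE ![x == _]eq_sym ![y == _]eq_sym.
have [->|_] := eqVneq a x; rewrite ?(negPf neq_xy) /=.
  by move=> ->; left.
by move=> _ -> _ ->; right.
Qed.

(** Each edge is the underlying set of exactly two ordered pairs. *)
Lemma sum_darts (K : sgraph) (F : {set K} -> nat) :
  \sum_(x : K) \sum_(y : K | adj x y) F [set x; y] =
  2 * \sum_(e in edges K) F e.
Proof.
rewrite pair_big_dep /=.
rewrite (partition_big (fun p : K * K => [set p.1; p.2]) (mem (edges K))) /=;
  last by move=> [x y] /= xy; apply/edgesP; exists x, y.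
rewrite big_distrr /=; apply: eq_bigr => e /edgesP[x [y [xy ->]]].
have neq_xy := adj_neq _ _ _ xy.
rewrite (eq_bigr (fun=> F [set x; y])); last by move=> p /andP[_ /eqP->].
rewrite sum_nat_const; congr (_ * _).
rewrite (@eq_card _ _ (mem [set (x, y); (y, x)])) => [|[a b]].
  by rewrite cards2 xpair_eqE (negPf neq_xy).
rewrite unfold_in /= eq_set2 // !inE.
apply: andb_idl => /orP[] /eqP[-> ->] //; by rewrite adj_sym.
Qed.

(** Adding a third vertex matches the common neighbours of [x] and [y] with the
    triangles through the edge [xy]. *)
Lemma card_common_nbhd (K : sgraph) (x y : K) : adj x y ->
  #|[set z : K | adj x z] :&: [set z : K | adj y z]| =
  #|[set t in triangles K | [set x; y] \subset t]|.
Proof.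
move=> xy; have neq_xy := adj_neq _ _ _ xy.
rewrite -(@card_in_imset _ _ (fun z => z |: [set x; y])); last first.
  move=> z w; rewrite !inE => /andP[xz yz] /andP[xw yw] /setP/(_ z).
  rewrite !inE eqxx /= !(eq_sym z) (negPf (adj_neq _ _ _ xz)).
  by rewrite (negPf (adj_neq _ _ _ yz)) !orbF => /esym/eqP.
apply: eq_card => t; rewrite [in RHS]inE; apply/imsetP/andP.
  move=> [z]; rewrite !inE => /andP[xz yz] ->; split; last exact: subsetUr.
  rewrite cardsU1 cards2 neq_xy !inE negb_or !(eq_sym z) !adj_neq //=.
  apply/forall_inP => a; rewrite !inE => ha.
  apply/forall_inP => b; rewrite !inE => hb.
  apply/implyP; move: ha hb.
  do 2![case/or3P=> /eqP->]; rewrite ?eqxx // => _; by rewrite // adj_sym.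
(* Conversely, the third vertex of [t] is the only element of [t :\: [set x; y]]. *)
rewrite inE => -[/andP[/eqP card_t /forall_inP adj_t] sub_t].
have : #|t :\: [set x; y]| == 1.
  by rewrite cardsD (setIidPr sub_t) card_t cards2 neq_xy.
move=> /cards1P[z def_z].
have : z \in t :\: [set x; y] by rewrite def_z set11.
rewrite !inE negb_or => /andP[/andP[neq_zx neq_zy] tz].
have adj_z v : v \in [set x; y] -> z != v -> adj v z.
  move=> xyv neq_zv; have /forall_inP/(_ z tz) := adj_t v (subsetP sub_t v xyv).
  by rewrite eq_sym neq_zv.
exists z; first by rewrite !inE !adj_z ?set21 ?set22.
by rewrite -def_z setUC -{1}(setIidPr sub_t) setID.
Qed.

(** A triangle contains three edges, namely all its two-element subsets. *)
Lemma sum_triangles_edges (K : sgraph) :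
  \sum_(e in edges K) #|[set t in triangles K | e \subset t]| =
  3 * num_triangles K.
Proof.
under eq_bigr => e _.
  rewrite -sum1dep_card big_mkcondr /=.
over.
rewrite exchange_big /= mulnC -sum_nat_const.
apply: eq_bigr => t; rewrite inE => /andP[/eqP card_t /forall_inP adj_t].
rewrite -big_mkcondr sum1dep_card /=.
transitivity 'C(#|t|, 2); last by rewrite card_t.
rewrite -cards_draws; apply: eq_card => e; rewrite [LHS]inE [RHS]inE andbC.
apply: andb_id2l => sub_e; apply/edgesP/cards2P.
  by move=> [x [y [xy ->]]]; exists x, y; split; first exact: adj_neq xy.
move=> [x [y [neq_xy def_e]]]; exists x, y; split=> //; move: sub_e.
rewrite def_e subUset !sub1set => /andP[tx ty].
by have /forall_inP/(_ y ty) := adj_t x tx; rewrite neq_xy.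
Qed.

(** Inclusion-exclusion; the ends of an edge are neighbours of each other, so
    open neighbourhoods may replace closed ones in the union. *)
Lemma ev_degree_common (K : sgraph) (x y : K) : adj x y ->
  ev_degree [set x; y] + #|[set t in triangles K | [set x; y] \subset t]| =
  degree x + degree y.
Proof.
move=> xy; rewrite ev_degreeE -card_common_nbhd // /degree -[RHS]cardsUI.
congr (#|pred_of_set _| + _); apply/setP => z; rewrite !inE.
have [->|_] := eqVneq z x; first by rewrite [adj y x]adj_sym xy !orbT.
by have [->|//] := eqVneq z y; rewrite xy.
Qed.

Lemma sum_ev_degree (K : sgraph) :
  \sum_(e in edges K) ev_degree e + 3 * num_triangles K = first_zagreb K.
Proof.
rewrite -sum_triangles_edges -big_split /=.
apply/eqP; rewrite -(eqn_pmul2l (isT : 0 < 2)) -sum_darts; apply/eqP.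
under eq_bigr => x _ do under eq_bigr => y xy do rewrite ev_degree_common //.
have sum_sq : \sum_(x : K) \sum_(y : K | adj x y) degree x = first_zagreb K.
  by apply: eq_bigr => x _; rewrite sum_nat_const /degree cardsE.
under eq_bigr => x _ do rewrite big_split /=.
rewrite big_split /= sum_sq mul2n -addnn; congr (_ + _).
rewrite (exchange_big_dep xpredT) //= -[RHS]sum_sq.
by apply: eq_bigr => y _; apply: eq_bigl => x; rewrite adj_sym.
Qed.

Lemma sum_ev_degree_sqr (K : sgraph) (n : nat) :
  \sum_(e in edges K) (ev_degree e + n) ^ 2 =
  ev_zagreb K + 2 * (n * \sum_(e in edges K) ev_degree e)
    + n ^ 2 * size_graph K.
Proof.
under eq_bigr => e _ do rewrite sqrnD [_ ^ 2 + n ^ 2 + _]addnAC.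
rewrite 2!big_split /= sum_nat_const [_ * n ^ 2]mulnC.
by rewrite -big_distrr -big_distrl /= [_ * n]mulnC.
Qed.

Lemma card_set_sum (S T : finType) (A : {set S + T}) :
  #|A| = #|inl @^-1: A| + #|inr @^-1: A|.
Proof.
rewrite -!sum1_card big_sumType /=.
by congr (_ + _); apply: eq_bigl => x; rewrite inE.
Qed.

Section Join.

Variables G H : sgraph.

Let J := join_graph G H.

(** The neighbourhoods in the join of two vertices of [G] restrict to their
    neighbourhoods in [G], and each of them contains all of [H]. *)
Lemma ev_degree_join_l (x y : G) :
  @ev_degree J [set inl x; inl y] = ev_degree [set x; y] + #|H|.
Proof.
rewrite !ev_degreeE card_set_sum -cardsT.
by congr (_ + _); apply: eq_card => z; rewrite !inE.
Qed.

Lemma ev_degree_join_r (x y : H) :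
  @ev_degree J [set inr x; inr y] = ev_degree [set x; y] + #|G|.
Proof.
rewrite !ev_degreeE card_set_sum -cardsT addnC.
by congr (_ + _); apply: eq_card => z; rewrite !inE.
Qed.

Lemma ev_degree_join_lr (x : G) (y : H) :
  @ev_degree J [set inl x; inr y] = #|G| + #|H|.
Proof.
rewrite ev_degreeE card_set_sum -!cardsT.
congr (_ + _); apply: eq_card => z; rewrite !inE //=.
by rewrite orbT.
Qed.

(** Ordered pairs of adjacent vertices of the join split by the sides of their two
    ends; a cross edge shows up once in each order, which the halving absorbs. *)
Lemma ev_zagreb_join :
  ev_zagreb J =
  \sum_(e in edges G) (ev_degree e + #|H|) ^ 2
  + \sum_(e in edges H) (ev_degree e + #|G|) ^ 2
  + #|G| * #|H| * (#|G| + #|H|) ^ 2.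
Proof.
have sum_l (x : G) :
    \sum_(v : J | adj (inl x : J) v) @ev_degree J [set inl x; v] ^ 2 =
    \sum_(y : G | adj x y) (ev_degree [set x; y] + #|H|) ^ 2
    + #|H| * (#|G| + #|H|) ^ 2.
  rewrite big_sumType -sum_nat_const; congr (_ + _); apply: eq_bigr => y _.
    by rewrite ev_degree_join_l.
  by rewrite ev_degree_join_lr.
have sum_r (y : H) :
    \sum_(v : J | adj (inr y : J) v) @ev_degree J [set inr y; v] ^ 2 =
    #|G| * (#|G| + #|H|) ^ 2
    + \sum_(x : H | adj y x) (ev_degree [set y; x] + #|G|) ^ 2.
  rewrite big_sumType -sum_nat_const; congr (_ + _); apply: eq_bigr => x _.
    by rewrite setUC ev_degree_join_lr.
  by rewrite ev_degree_join_r.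
apply/eqP; rewrite -(eqn_pmul2l (isT : 0 < 2)) !mulnDr -!sum_darts big_sumType.
rewrite (eq_bigr _ (fun x _ => sum_l x)).
rewrite [X in _ + X == _](eq_bigr _ (fun y _ => sum_r y)).
rewrite !big_split /= !sum_nat_const; apply/eqP; ring.
Qed.

End Join.

Local Open Scope ring_scope.

Theorem theorem3p1 (G H : sgraph) (hG : connected_graph G)
  (hH : connected_graph H) :
  (ev_zagreb (join_graph G H))%:Z =
    (ev_zagreb G)%:Z + (ev_zagreb H)%:Z
    + 2 * (order_graph H)%:Z * (first_zagreb G)%:Z
    + 2 * (order_graph G)%:Z * (first_zagreb H)%:Z
    - 6 * (order_graph H)%:Z * (num_triangles G)%:Z
    - 6 * (order_graph G)%:Z * (num_triangles H)%:Z
    + (order_graph H)%:Z ^+ 2 * (size_graph G)%:Z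
    + (order_graph G)%:Z ^+ 2 * (size_graph H)%:Z
    + ((order_graph G)%:Z + (order_graph H)%:Z) ^+ 2
      * (order_graph G)%:Z * (order_graph H)%:Z.
Proof.
(* Eliminating [M_1] in favour of the sums of ev-degrees makes the [eta] terms
   cancel and leaves a polynomial identity. *)
rewrite ev_zagreb_join !sum_ev_degree_sqr -!sum_ev_degree /order_graph.
rewrite !(PoszD, PoszM, expnS, expn0).
ring.
Qed.
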